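(* Let $\mathcal{G}$ be a graph with the following property: there exists an odd vertex $v$ such that $d(v,w)\geq 3$ for any other odd vertex $w$. Then $\mathfrak{n}_{\mathcal{G}}$ does not admit any adapted complex structure.
   Context: Graphs are finite and simple. A vertex is odd if its degree is odd. The distance $d(v,w)$ is the number of edges in a shortest path between $v$ and $w$, and $+\infty$ if there is no such path. For a graph $\mathcal{G}=(V,E)$ label $V=\{v_1,\dots,v_n\}$ and write $e_{i,j}$ ($i<j$) for the edge joining $v_i$ and $v_j$, if it exists. The Lie algebra $\mathfrak{n}_{\mathcal{G}}$ is the real vector space with basis $V\cup E$ and Lie bracket $[v_i,v_j]=e_{i,j}$ for $i<j$ if $v_i,v_j$ are adjacent, $[v_i,v_j]=0$ if they are not adjacent, and all elements of $E$ central. A complex structure on a real Lie algebra $\mathfrak{g}$ is a linear map $J:\mathfrak{g}\to\mathfrak{g}$ with $J^2=-\mathrm{Id}$ and $[x,y]+J([Jx,y]+[x,Jy])-[Jx,Jy]=0$ for all $x,y\in\mathfrak{g}$. A complex structure $J$ on $\mathfrak{n}_{\mathcal{G}}$ is adapted if for every $x\in V\cup E$ either $Jx\in V\cup E$ or $-Jx\in V\cup E$. *)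

(* Defs.v *)
From mathcomp Require Import all_boot all_order all_algebra.
From mathcomp Require Import boolp reals constructive_ereal.
Set Implicit Arguments.
Unset Strict Implicit.
Unset Printing Implicit Defensive.
Import Order.TTheory GRing.Theory Num.Theory.
Local Open Scope ring_scope.

Record sgraph := SGraph {
  vertex :> finType;
  adj : rel vertex;
  adj_sym : symmetric adj;
  adj_irr : irreflexive adj
}.

Section GraphDefs.
Variable G : sgraph.

Definition deg (v : G) : nat := #|[set w : G | adj v w]|.

Definition odd_vertex (v : G) : bool := odd (deg v).

(* v :: p lists the vertices of a path, so k = size p counts its edges *)
Definition has_path (v w : G) (k : nat) : bool :=
  [exists p : k.-tuple G,
     [&& path (@adj G) v p, uniq (v :: p) & last v p == w]].

Definition dist (v w : G) : \bar int :=
  match pselect (exists k, has_path v w k) with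
  | left h => (ex_minn h)%:Z%:E
  | right _ => +oo%E
  end.

(* The labelling v_1, ..., v_n of the vertices is the enumeration of the
   finType, so that e_(i,j) with i < j is the pair (v_i, v_j). *)
Definition is_edge : pred (G * G) :=
  [pred p : G * G | adj p.1 p.2 && (enum_rank p.1 < enum_rank p.2)%N].

Definition edge : Type := {p : G * G | is_edge p}.

End GraphDefs.

Record lieAlgebra (R : fieldType) := LieAlgebra {
  lie_space :> vectType R;
  lie_br : lie_space -> lie_space -> lie_space;
  lie_br_linl : forall a x y z,
    lie_br (a *: x + y) z = a *: lie_br x z + lie_br y z;
  lie_br_linr : forall a x y z,
    lie_br z (a *: x + y) = a *: lie_br z x + lie_br z y;
  lie_br_alt : forall x, lie_br x x = 0;
  lie_br_jacobi : forall x y z,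
    lie_br x (lie_br y z) + lie_br y (lie_br z x) + lie_br z (lie_br x y) = 0
}.

Definition complex_structure (R : realType) (g : lieAlgebra R)
    (J : 'End(g)) : Prop :=
  (forall x, J (J x) = - x) /\
  (forall x y, lie_br x y + J (lie_br (J x) y + lie_br x (J y))
               - lie_br (J x) (J y) = 0).

Section GraphLieAlgebra.
Variables (R : realType) (G : sgraph).

Definition gspace : vectType R := {ffun (G + edge G)%type -> R^o}.

Definition gbasis (b : G + edge G) : gspace := [ffun c => (b == c)%:R].

Definition gbasis_br (b c : G + edge G) : gspace :=
  match b, c with
  | inl u, inl w =>
      if insub (u, w) is Some e then gbasis (inr e)
      else if insub (w, u) is Some e then - gbasis (inr e)
      else 0
  | _, _ => 0
  end.

Definition gbr (x y : gspace) : gspace :=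
  \sum_b \sum_c ((x : {ffun _ -> R^o}) b * (y : {ffun _ -> R^o}) c)
    *: gbasis_br b c.

Lemma gbr_linl a x y z : gbr (a *: x + y) z = a *: gbr x z + gbr y z.
Proof.
rewrite /gbr scaler_sumr -big_split; apply: eq_bigr => b _ /=.
rewrite scaler_sumr -big_split; apply: eq_bigr => c _ /=.
by rewrite !ffunE scalerA -scalerDl mulrDl -mulrA.
Qed.

Lemma gbasis_br_anti b c : gbasis_br c b = - gbasis_br b c.
Proof.
case: b c => [u|e] [w|f] /=; rewrite ?oppr0 //.
case: insubP => [e /andP[/= _ h] _|_].
  case: insubP => [f /andP[/= _ h'] _|_]; last by rewrite opprK.
  by move: (ltn_trans h h'); rewrite ltnn.
by case: insubP => [f _ _|_]; rewrite ?oppr0.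
Qed.

Lemma gbr_anti x y : gbr y x = - gbr x y.
Proof.
rewrite /gbr exchange_big -sumrN; apply: eq_bigr => b _ /=.
rewrite -sumrN; apply: eq_bigr => c _ /=.
by rewrite gbasis_br_anti scalerN mulrC.
Qed.

Lemma gbr_linr a x y z : gbr z (a *: x + y) = a *: gbr z x + gbr z y.
Proof. by rewrite gbr_anti gbr_linl (gbr_anti x) (gbr_anti y) scalerN opprD. Qed.

Lemma gbr_alt x : gbr x x = 0.
Proof.
have /eqP := gbr_anti x x; rewrite -addr_eq0 -mulr2n -scaler_nat scaler_eq0.
by rewrite pnatr_eq0 /= => /eqP.
Qed.

Lemma gbr_gbasis b c : gbr (gbasis b) (gbasis c) = gbasis_br b c.
Proof.
rewrite /gbr (bigD1 b) //= [X in _ + X]big1 ?addr0; last first.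
  move=> b' nb; apply: big1 => c' _.
  by rewrite ffunE eq_sym (negPf nb) mul0r scale0r.
rewrite (bigD1 c) //= big1 ?addr0; last first.
  by move=> c' nc; rewrite [X in _ * X]ffunE eq_sym (negPf nc) mulr0 scale0r.
by rewrite !ffunE !eqxx mulr1 scale1r.
Qed.

Lemma gbr_vertex x y (u : G) : (gbr x y : {ffun _ -> R^o}) (inl u) = 0.
Proof.
rewrite /gbr sum_ffunE big1 // => b _; rewrite sum_ffunE big1 // => c _.
rewrite ffunE; case: b c => [v|e] [w|f] /=; rewrite ?ffunE ?scaler0 //.
case: insubP => [e _ _|_]; first by rewrite !ffunE scaler0.
by case: insubP => [e _ _|_]; rewrite !ffunE ?oppr0 scaler0.
Qed.

Lemma gbr_nil x y z : gbr x (gbr y z) = 0.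
Proof.
rewrite {1}/gbr big1 // => b _; rewrite big1 // => -[u|e] _.
  by rewrite gbr_vertex mulr0 scale0r.
by case: b => ? /=; rewrite scaler0.
Qed.

Lemma gbr_jacobi x y z :
  gbr x (gbr y z) + gbr y (gbr z x) + gbr z (gbr x y) = 0.
Proof. by rewrite !gbr_nil !addr0. Qed.

Definition graph_lie : lieAlgebra R :=
  LieAlgebra gbr_linl gbr_linr gbr_alt gbr_jacobi.

Definition adapted (J : 'End(graph_lie)) : Prop :=
  forall b : G + edge G,
    (exists c, J (gbasis b) = gbasis c) \/ (exists c, - J (gbasis b) = gbasis c).

End GraphLieAlgebra.

(* Main.v *)
Require Import Defs.
From mathcomp Require Import all_boot all_order all_algebra.
From mathcomp Require Import boolp reals constructive_ereal.
From mathcomp Require Import ring lra.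
Import Order.TTheory GRing.Theory Num.Theory.
Local Open Scope ring_scope.

(** An adapted complex structure J induces a fixed-point-free involution s on
    V ∪ E with J b = ± s b. Extend adjacency to V ∪ E by making edges isolated.
    The four terms of the integrability condition at (b, c) are zero or signed
    basis vectors, so adding up coordinates and reducing modulo 2 shows that an
    even number of the pairs (b, c), (s b, c), (b, s c), (s b, s c) are adjacent.
    Hence the symmetric difference of the neighbourhoods of b and s b is stable
    under s, so it has even size: if v is an odd vertex, then w = s v is again an
    odd vertex. If d(v, w) >= 3, then v and w have no common neighbour, and
    integrability at (v, y) forces s to preserve the neighbourhood of v: the
    only other possibility, [v, y] = ± [w, s y], would identify two different
    edges. So v has even degree, a contradiction. *)

(** [X] splits into two-element orbits [{x, s x}]; the induction removes one orbit at a time. *)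
Lemma involution_card_even (T : finType) (s : T -> T) (X : {set T}) :
  involutive s -> (forall x, s x != x) -> (forall x, x \in X -> s x \in X) ->
  ~~ odd #|X|.
Proof.
move=> sK sN; have [n] := ubnP #|X|; elim: n X => // n IH X leXn sX.
have [->|[x xX]] := set_0Vmem X; first by rewrite cards0.
have sxX : s x \in X :\ x by rewrite !inE sN sX.
have cX : #|X| = #|X :\ x :\ s x|.+2.
  by rewrite (cardsD1 x) xX (cardsD1 (s x)) sxX.
rewrite cX /= negbK; apply: IH => [|y].
  by move: leXn; rewrite cX !ltnS => /ltnW.
rewrite !inE => /and3P[ysx yx yX].
by rewrite sX // andbT (inj_eq (inv_inj sK)) yx /= -[x]sK (inj_eq (inv_inj sK)).
Qed.

Lemma odd_card_symdiff (T : finType) (P Q : pred T) :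
  odd #|[set x | P x (+) Q x]| = odd #|[set x | P x]| (+) odd #|[set x | Q x]|.
Proof.
rewrite -!sum1dep_card big_mkcond (big_mkcond P) (big_mkcond Q) /=.
apply: (big_ind3 (fun a b c => odd a = odd b (+) odd c)) => // [a b c a' b' c' ea ea'|x _].
  by rewrite !oddD ea ea' addbACA.
by case: (P x); case: (Q x).
Qed.

(** A sum of k signs ±1 has the parity of k, so it can vanish only for even k. *)
Lemma odd_signed_sum4 (R : realType) (s1 s2 s3 s4 a1 a2 a3 a4 : bool) :
  (-1) ^+ s1 * a1%:R + (-1) ^+ s2 * a2%:R + (-1) ^+ s3 * a3%:R
    + (-1) ^+ s4 * a4%:R = 0 :> R ->
  a1 (+) a2 (+) a3 (+) a4 = false.
Proof.
case: a1; case: a2; case: a3; case: a4 => //=;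
  case: s1; case: s2; case: s3; case: s4; rewrite ?expr0 ?expr1 => ?; lra.
Qed.

Lemma dist_le (G : sgraph) (v w : G) (k : nat) :
  has_path v w k -> (dist v w <= k%:Z%:E)%E.
Proof.
move=> h; rewrite /dist; case: pselect => [ex|[]]; last by exists k.
by case: ex_minnP => m _ /(_ k h); rewrite lee_fin lez_nat.
Qed.

Lemma dist_adj (G : sgraph) (v w : G) :
  v != w -> adj v w -> (dist v w <= 1%:E)%E.
Proof.
move=> vw a; apply: (dist_le _ _ _ 1%N); apply/existsP; exists [tuple w].
by rewrite /= a inE vw eqxx.
Qed.

Lemma dist_common_neighbour (G : sgraph) (v y w : G) :
  v != w -> adj v y -> adj w y -> (dist v w <= 2%:E)%E.
Proof.
move=> vw vy wy; apply: (dist_le _ _ _ 2%N); apply/existsP; exists [tuple y; w].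
rewrite /= vy [adj y w]adj_sym wy !inE negb_or vw eqxx !andbT /=.
(* [has_path] requires distinct vertices; irreflexivity separates [y] from both ends. *)
apply/andP; split; first by apply/eqP=> e; move: vy; rewrite e adj_irr.
by apply/eqP=> e; move: wy; rewrite e adj_irr.
Qed.

Section AdaptedStructures.
Context {R : realType} {G : sgraph}.
Implicit Types b c : G + edge G.

Local Notation gb := (@gbasis R G).
Local Notation br := (@gbr R G).

Definition badj b c : bool :=
  if (b, c) is (inl u, inl w) then adj u w else false.

Lemma card_badj (v : G) : #|[set c | badj (inl v) c]| = deg v.
Proof.
rewrite /deg -(card_imset _ (@inl_inj G (edge G))); congr #|pred_of_set _|.
apply/setP=> -[w|e]; rewrite !inE /=.
  by rewrite mem_imset ?inE //; exact: inl_inj.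
by apply/esym/negbTE/imsetP => -[].
Qed.

Lemma signed_gbasis_inj (t : bool) b c : gb b = (-1) ^+ t *: gb c -> b = c.
Proof.
move=> /(congr1 (fun x : {ffun _ -> R^o} => x b)) /eqP; rewrite !ffunE eqxx.
by have [//|_] := eqVneq c b; rewrite scaler0 oner_eq0.
Qed.

(** The flag [a] separates ± a basis vector from zero; it is the coordinate sum of [x] modulo 2. *)
Definition signed_gbasis (a : bool) (x : gspace R G) : Prop :=
  exists t c, x = (-1) ^+ (t : bool) *: (a%:R *: gb c).

Lemma signed_gbasisZ a x (t : bool) :
  signed_gbasis a x -> signed_gbasis a ((-1) ^+ t *: x).
Proof.
by move=> [u [c ->]]; exists (t (+) u), c; rewrite scalerA signr_addb.
Qed.

Lemma signed_gbasis_sum4 (a1 a2 a3 a4 : bool) (x1 x2 x3 x4 : gspace R G) :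
  signed_gbasis a1 x1 -> signed_gbasis a2 x2 -> signed_gbasis a3 x3 ->
  signed_gbasis a4 x4 -> x1 + x2 + x3 + x4 = 0 ->
  a1 (+) a2 (+) a3 (+) a4 = false.
Proof.
pose S (x : {ffun G + edge G -> R^o}) : R := \sum_b x b.
have SD x y : S (x + y) = S x + S y.
  by rewrite /S -big_split; apply: eq_bigr => b _; rewrite ffunE.
have Sb (t a : bool) c : S ((-1) ^+ t *: (a%:R *: gb c)) = (-1) ^+ t * a%:R.
  rewrite /S (bigD1 c) //= big1 => [|b nb]; rewrite !ffunE.
    by rewrite eqxx addr0 /GRing.scale /= mulr1.
  by rewrite eq_sym (negbTE nb) !scaler0.
move=> [t1 [c1 ->]] [t2 [c2 ->]] [t3 [c3 ->]] [t4 [c4 ->]] /(congr1 S).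
rewrite !SD !Sb {1}/S big1 => [|b _]; last by rewrite ffunE.
exact: odd_signed_sum4.
Qed.

Lemma gbr_gbasis_edge (u w : G) : adj u w ->
  exists (t : bool) (e : edge G), br (gb (inl u)) (gb (inl w)) = (-1) ^+ t *: gb (inr e)
    /\ (val e = (u, w) \/ val e = (w, u)).
Proof.
move=> a; rewrite gbr_gbasis /=; case: insubP => [e _ ve|n1].
  by exists false, e; rewrite scale1r; split; last left.
case: insubP => [e _ ve|n2].
  by exists true, e; rewrite scaleN1r; split; last right.
(* If neither orientation is an edge, the ranks of [u] and [w] agree, so [u] would be adjacent to
   itself. *)
move: n1 n2; rewrite /is_edge /= a [adj w u]adj_sym a /= -!leqNgt => n1 n2.
have /enum_rank_inj uw : enum_rank u = enum_rank w.
  by apply/val_inj/eqP; rewrite eqn_leq n1 n2.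
by move: a; rewrite uw adj_irr.
Qed.

Lemma gbr_gbasis_badjN b c : ~~ badj b c -> br (gb b) (gb c) = 0.
Proof.
rewrite gbr_gbasis; case: b c => [u|?] [w|?] //=; rewrite /badj => /negbTE n.
by rewrite !insubF // /is_edge /= ?[adj w u]adj_sym n.
Qed.

Lemma signed_gbr b c : signed_gbasis (badj b c) (br (gb b) (gb c)).
Proof.
have [a|n] := boolP (badj b c); last first.
  by exists false, b; rewrite gbr_gbasis_badjN // scale0r scaler0.
case: b c a => [u|?] [w|?] //= /gbr_gbasis_edge [t [e [-> _]]].
by exists t, (inr e); rewrite scale1r.
Qed.

(** A nonzero bracket of two vertices is ± the basis vector of their edge, hence determines its
    endpoints. Adjacency of [u'] and [w'] is forced, as the right-hand side would otherwise
    vanish. *)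
Lemma gbr_gbasis_endpoints (u w u' w' : G) (t : bool) : adj u w ->
  br (gb (inl u)) (gb (inl w)) = (-1) ^+ t *: br (gb (inl u')) (gb (inl w')) ->
  u = u' \/ u = w'.
Proof.
move=> /gbr_gbasis_edge [s [e [-> ve]]].
have [a|n] := boolP (badj (inl u') (inl w')); last first.
  rewrite (gbr_gbasis_badjN _ _ n) => /(congr1 ( *:%R ((-1) ^+ s))).
  rewrite scalerA -signr_addb addbb scale1r !scaler0 -(scaler0 _ ((-1) ^+ false)).
  move=> /(congr1 (fun x : {ffun _ -> R^o} => x (inr e))) /eqP.
  by rewrite !ffunE eqxx scaler0 oner_eq0.
have [s' [e' [-> ve']]] := gbr_gbasis_edge _ _ a.
move=> /(congr1 ( *:%R ((-1) ^+ s))).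
rewrite !scalerA -!signr_addb addbb scale1r => /signed_gbasis_inj [ee].
by move: ve; rewrite ee; case: ve' => -> [] [-> ->]; [left|right|right|left].
Qed.

Variable J : 'End(graph_lie R G).
Hypothesis JK : forall x, J (J x) = - x.
Hypothesis JI : forall x y : gspace R G,
  br x y + J (br (J x) y + br x (J y)) - br (J x) (J y) = 0.
Variables (s : G + edge G -> G + edge G) (sg : G + edge G -> bool).
Hypothesis Js : forall b, J (gb b) = (-1) ^+ sg b *: gb (s b).

Lemma adapted_perm_signK b : gb b = (-1) ^+ (~~ (sg b (+) sg (s b))) *: gb (s (s b)).
Proof.
have := JK (gb b); rewrite Js linearZ /= Js scalerA -signr_addb.
move=> /(congr1 -%R); rewrite opprK => <-.
by rewrite -scaleNr signrN.
Qed.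

Lemma adapted_permK : involutive s.
Proof. by move=> b; have /signed_gbasis_inj := adapted_perm_signK b. Qed.

(** A fixed point would give an eigenvector of [J] with eigenvalue ±1, whose square is not -1. *)
Lemma adapted_permN b : s b != b.
Proof.
apply/eqP=> sb; have := adapted_perm_signK b; rewrite !sb addbb /= expr1 scaleN1r.
move=> /(congr1 (fun x : {ffun _ -> R^o} => x b)); rewrite !ffunE eqxx => e.
have : 1 = -1 :> R by exact: e.
lra.
Qed.

Lemma signed_gbasisJ a x : signed_gbasis a x -> signed_gbasis a (J x).
Proof.
move=> [t [c ->]]; rewrite !linearZ /= Js.
by exists (t (+) sg c), (s c); rewrite signr_addb !scalerA; congr (_ *: _); ring.
Qed.

Lemma gbrZl a x y : br (a *: x) y = a *: br x y.
Proof.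
have /(_ y) gbr0 : forall y, br 0 y = 0.
  move=> z; have := gbr_linl 1 0 0 z; rewrite scaler0 addr0 scale1r => e.
  by apply: (addrI (br 0 z)); rewrite -e addr0.
by have := gbr_linl a x 0 y; rewrite gbr0 !addr0.
Qed.

Lemma gbrZr a x y : br y (a *: x) = a *: br y x.
Proof. by rewrite gbr_anti gbrZl -scalerN -gbr_anti. Qed.

(** All signs are absorbed into powers of -1, giving the four-term shape that [signed_gbasis_sum4]
    expects. *)
Lemma adapted_integrability b c :
  br (gb b) (gb c) + J ((-1) ^+ sg b *: br (gb (s b)) (gb c))
  + J ((-1) ^+ sg c *: br (gb b) (gb (s c)))
  + (-1) ^+ (~~ (sg b (+) sg c)) *: br (gb (s b)) (gb (s c)) = 0.
Proof.
have := JI (gb b) (gb c); rewrite !Js !gbrZl !gbrZr linearD scalerA -signr_addb.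
by rewrite -scaleNr -signrN addrA.
Qed.

Lemma adapted_badj b c :
  badj b c (+) badj (s b) c (+) badj b (s c) (+) badj (s b) (s c) = false.
Proof.
apply: signed_gbasis_sum4 (adapted_integrability b c).
- exact: signed_gbr.
- exact/signed_gbasisJ/signed_gbasisZ/signed_gbr.
- exact/signed_gbasisJ/signed_gbasisZ/signed_gbr.
- exact/signed_gbasisZ/signed_gbr.
Qed.

Lemma odd_card_badj_perm b :
  odd #|[set c | badj (s b) c]| = odd #|[set c | badj b c]|.
Proof.
apply/esym/eqP; rewrite -[_ == _]negbK -negb_add -odd_card_symdiff.
rewrite negbK; apply: involution_card_even adapted_permK adapted_permN _ => c.
(* Exactly one of the pairs with [c] is adjacent, so by parity exactly one of those with [s c]
   is. *)
rewrite !inE => bc; have := adapted_badj b c.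
by rewrite bc addTb addNb => /negbFE.
Qed.

Lemma adapted_neighbourhood_stable (v w : G) (c : G + edge G) :
  s (inl v) = inl w -> v != w -> ~~ badj (inl v) (inl w) ->
  (forall y, adj v y -> ~~ adj w y) ->
  badj (inl v) c -> badj (inl v) (s c).
Proof.
move=> sv vw nvw nc vc; have := adapted_badj (inl v) c; rewrite sv.
case: c vc => [y|//] vy; have vy' : adj v y := vy.
have wy : badj (inl w) (inl y) = false by apply/negbTE/nc.
rewrite vy wy /=; case vz: (badj _ (s _)) => //= /negbFE wz.
(* In the remaining case the two middle terms vanish, leaving [v, y] = ± [w, s y]. *)
have := adapted_integrability (inl v) (inl y).
rewrite sv (gbr_gbasis_badjN _ _ (negbT wy)) (gbr_gbasis_badjN _ _ (negbT vz)).
rewrite !scaler0 !linear0 !addr0 => /eqP; rewrite addr_eq0 -scaleNr -signrN => /eqP.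
(* So [v] is an endpoint of the edge joining [w] and [z]: either [v = w], or [v = z] is adjacent to
   [w]. *)
case: (s _) wz => // z wz /(gbr_gbasis_endpoints _ _ _ _ _ vy') [e|e].
  by rewrite e eqxx in vw.
by move: nvw wz; rewrite /badj e adj_sym => /negbTE ->.
Qed.

End AdaptedStructures.

Theorem corollary4p12 (R : realType) (G : sgraph)
  (hG : exists2 v : G, odd_vertex v &
          forall w : G, w != v -> odd_vertex w -> (3%:E <= dist v w)%E) :
  ~ exists J : 'End(graph_lie R G), complex_structure J /\ adapted J.
Proof.
case: hG => v ov far [J [[JK JI] aJ]].
have /choice[f fP] b : exists p : (G + edge G) * bool,
    J (gbasis R b) = (-1) ^+ p.2 *: gbasis R p.1.
  case: (aJ b) => -[c Jc]; [exists (c, false)|exists (c, true)].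
    by rewrite scale1r.
  by rewrite scaleN1r -Jc opprK.
pose s b := (f b).1; pose sg b := (f b).2.
have Js b : J (gbasis R b) = (-1) ^+ sg b *: gbasis R (s b) by exact: fP.
have sK := adapted_permK J JK s sg Js; have sN := adapted_permN J JK s sg Js.
have := odd_card_badj_perm J JK JI s sg Js (inl v); rewrite card_badj [odd (deg v)]ov.
(* If [s v] were an edge, its neighbourhood would be empty, hence of even size. *)
case sv: (s (inl v)) => [w|e]; last by rewrite (_ : [set _ | _] = set0) ?cards0.
rewrite card_badj => ow.
have wv : w != v by apply: contraNneq (sN (inl v)) => e; rewrite sv e.
have vw : v != w by rewrite eq_sym.
have d3 := far w wv ow.
have nvw : ~~ adj v w.
  by apply/negP=> /(dist_adj _ _ _ vw)/(le_trans d3).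
have nc y : adj v y -> ~~ adj w y.
  move=> vy; apply/negP=> wy.
  by have := le_trans d3 (dist_common_neighbour _ _ _ _ vw vy wy).
(* The neighbourhood of [v] is stable under [s], so its size is even, against the choice of [v]. *)
have := involution_card_even _ _ [set c | badj (inl v) c] sK sN.
rewrite card_badj [odd _]ov => /(_ _)/negP; apply=> // c; rewrite !inE.
exact: adapted_neighbourhood_stable J JI s sg Js _ _ _ sv vw nvw nc.
Qed.
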